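(* Let $d\ge1$ and consider the bootstrap percolation (BP) on $\mathbb Z^d$ with update family $\mathcal X$ contained in a half-space, i.e. such that there exists $u\in\mathbb R^d$ with $\langle x,u\rangle<0$ for all $X\in\mathcal X$ and all $x\in X$. Let the initial condition be i.i.d. Bernoulli with parameter $q$, and denote by $\mu_q$ the resulting law. Set $$q_{\mathrm c}=\inf\left\{q\in[0,1]:\lim_{t\to\infty}\mu_q(\eta_0(t)\neq1)=0\right\}.$$ Then for all $q\in[0,1]$ with $q>q_{\mathrm c}$ there exist $c,C>0$ such that for all integers $t>0$, $$\mu_q\left(\eta_0(t)\neq 1\right)\le Ce^{-ct}.$$
   Context: An update family is a finite family $\mathcal X$ of finite subsets of $\mathbb Z^d\setminus\{0\}$ (both the family and the sets in it may be empty). The BP with update family $\mathcal X$ is the discrete-time deterministic process on $\{0,1\}^{\mathbb Z^d}$ in which, at each time step, simultaneously for all sites, the state of a site $x\in\mathbb Z^d$ becomes $1$ if it is already $1$ or there exists $X\in\mathcal X$ such that all elements of $x+X$ are in state $1$; otherwise the state of $x$ is $0$. The configuration at time $t$ is denoted $\eta(t)=(\eta_x(t))_{x\in\mathbb Z^d}$. By convention the initial condition is the state at time $-1$, so that $\eta(0)$ is the state after one step. *)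

(* Defs.v *)
From HB Require Import structures.
From mathcomp Require Import all_boot all_order all_algebra finmap zify.
From mathcomp Require Import all_classical all_reals all_analysis.
From mathcomp Require Import measurable_realfun.
From mathcomp Require Import ring lra.

Set Implicit Arguments.
Unset Strict Implicit.
Unset Printing Implicit Defensive.
Import Order.TTheory GRing.Theory Num.Theory.
Import numFieldNormedType.Exports.
Local Open Scope classical_set_scope.
Local Open Scope ring_scope.

Definition coordinate_events (I : Type) : set (set (I -> bool)) :=
  [set A | exists i (B : set bool), A = [set w | B (w i)]].

(* {0,1}^I with the product sigma-algebra; [true] is the state 1. *)
Definition configuration (I : Type) :=
  g_sigma_algebraType (@coordinate_events I).

Definition iid_bernoulli (R : realType) (I : choiceType) (q : R)
    (mu : probability (configuration I) R) :=
  forall (S : {fset I}) (A : I -> set bool),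
    mu [set w | forall i, i \in S -> A i (w i)] =
    (\prod_(i <- S) bernoulli_prob q (A i))%E.

(* Existence of the product measure for a countable I, by pushing the uniform
   measure on [0, 1] forward along the digits of a point x: the first digit is 1
   iff x < p, and the next ones are the digits of x rescaled from [0, p[ or
   [p, 1[ to [0, 1[. *)
Section digits.
Context (R : realType) (p : R).
Hypothesis p01 : 0 <= p <= 1.

Definition rescale (x : R) : R := if x < p then p^-1 * x else (1 - p)^-1 * (x - p).
Definition digit (n : nat) (x : R) : bool := iter n rescale x < p.

Let weight (b : bool) : R := if b then p else 1 - p.

Lemma digits_itv (n : nat) (b : nat -> bool) :
  exists a : R, [/\ 0 <= a, a + \prod_(k < n) weight (b k) <= 1 &
    [set x : R | 0 <= x < 1 /\ forall k, (k < n)%N -> digit k x = b k] =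
    [set` `[a, a + \prod_(k < n) weight (b k)[ ] ].
Proof.
have /andP[p0 p1] := p01.
have w0 c : 0 <= weight c by rewrite /weight; case: c; lra.
elim: n b => [|n IHn] b.
  exists 0; rewrite big_ord0; split; [lra|lra|].
  by apply/seteqP; split => x /=; rewrite in_itv/= add0r // => -[].
have [a [a0 a1 aE]] := IHn (fun k => b k.+1).
rewrite big_ord_recl /=; set l := \prod_(i < n) _ in a1 aE *.
have l0 : 0 <= l by apply: prodr_ge0.
have split_digits x : (forall k, (k < n.+1)%N -> digit k x = b k) <->
    digit 0 x = b 0%N /\ forall k, (k < n)%N -> digit k (rescale x) = b k.+1.
  split=> [h|[h0 h] [|k] //].
    by split=> [|k kn]; [exact: h|rewrite -h// /digit iterSr].
  by rewrite ltnS => kn; rewrite -h// /digit iterSr.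
have mem y : 0 <= y < 1 /\ (forall k, (k < n)%N -> digit k y = b k.+1) <->
    a <= y < a + l.
  move/seteqP : aE => [h1 h2]; split=> h.
    by have /= := h1 y h; rewrite in_itv.
  by apply: h2 => /=; rewrite in_itv.
case b0 : (b 0%N); rewrite /weight.
- exists (p * a); split; [nra|nra|].
  apply/seteqP; split => x /=; rewrite in_itv/= split_digits b0 /digit /=.
    move=> [x01 [xp h]]; have pp : 0 < p by lra.
    move: h; rewrite /rescale xp => h.
    have [h1 h2] : a <= p^-1 * x /\ p^-1 * x < a + l.
      apply/andP/mem; split => //; apply/andP; split.
        by rewrite mulr_ge0 ?invr_ge0//; lra.
      by rewrite mulrC ltr_pdivrMr// mul1r.
    move: h1 h2; rewrite mulrC ler_pdivlMr// ltr_pdivrMr// => h1 h2.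
    by apply/andP; split; lra.
  move=> /andP[xal xar].
  have pp : 0 < p.
    rewrite lt_neqAle eq_sym; apply/andP; split; last lra.
    by apply/eqP => p0'; move: xal xar; rewrite ?p0' !mul0r; lra.
  have xp : x < p by nra.
  have /mem[h1 h2] : a <= p^-1 * x < a + l.
    rewrite mulrC ler_pdivlMr// ltr_pdivrMr//; apply/andP; split; lra.
  split; first by apply/andP; split; nra.
  by split=> //; rewrite /rescale xp.
- exists (p + (1 - p) * a); split; [nra|nra|].
  apply/seteqP; split => x /=; rewrite in_itv/= split_digits b0 /digit /=.
    move=> [x01 [xp h]]; have pp : 0 < 1 - p by move/negbT: xp; rewrite -leNgt; lra.
    move: h; rewrite /rescale xp => h.
    have px : p <= x by rewrite leNgt xp.
    have [h1 h2] : a <= (1 - p)^-1 * (x - p) /\ (1 - p)^-1 * (x - p) < a + l.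
      apply/andP/mem; split => //; apply/andP; split.
        by rewrite mulr_ge0 ?invr_ge0//; lra.
      by rewrite mulrC ltr_pdivrMr// mul1r; lra.
    move: h1 h2; rewrite mulrC ler_pdivlMr// ltr_pdivrMr// => h1 h2.
    by apply/andP; split; lra.
  move=> /andP[xal xar].
  have pp : 0 < 1 - p.
    rewrite lt_neqAle eq_sym; apply/andP; split; last lra.
    by apply/eqP => p0'; move: xal xar; rewrite ?p0' !mul0r; lra.
  have px : p <= x by nra.
  have xp : (x < p) = false by rewrite ltNge px.
  have /mem[h1 h2] : a <= (1 - p)^-1 * (x - p) < a + l.
    rewrite mulrC ler_pdivlMr// ltr_pdivrMr//; apply/andP; split; lra.
  split; first by apply/andP; split; nra.
  by split=> //; rewrite /rescale xp.
Qed.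

Lemma measurable_rescale : measurable_fun setT rescale.
Proof.
apply: measurable_fun_ifT => //=.
- exact: measurable_fun_ltr.
- by apply: measurable_funM => //; exact: measurable_funB.
Qed.

Lemma measurable_digit n : measurable_fun setT (digit n).
Proof.
apply: measurable_fun_ltr => //.
elim: n => [|n IHn] /=; first exact: measurable_id.
exact: (measurableT_comp measurable_rescale IHn).
Qed.

Local Notation unif := (uniform_prob (@ltr01 R)).

Lemma uniform_digits (n : nat) (b : nat -> bool) :
  unif [set x | forall k, (k < n)%N -> digit k x = b k] =
  (\prod_(k < n) weight (b k))%:E.
Proof.
have [a [a0 a1 aE]] := digits_itv n b.
set l := \prod_(k < n) _ in a1 aE *.
have l0 : 0 <= l by apply: prodr_ge0 => i _; rewrite /weight; case: (b i); move: p01; lra.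
set E := [set x | _].
have mE : measurable E.
  rewrite (_ : E = \bigcap_(k in `I_n) (digit k @^-1` [set b k])) //.
  apply: bigcap_measurableType => // k _.
  by rewrite -[X in measurable X]setTI; exact: measurable_digit.
have unif_itv (c e : R) : 0 <= c -> 0 <= e -> c + e <= 1 ->
    unif [set` `[c, c + e[ ] = e%:E.
  move=> c0 e0 ce1; rewrite /uniform_prob integral_uniform_pdf setIidl; last first.
    by move=> x /=; rewrite !in_itv/= => /andP[? ?]; apply/andP; split; lra.
  rewrite (eq_integral (cst 1%E)).
    rewrite integral_cst//= lebesgue_measure_itv/= lte_fin mul1e.
    by case: ifPn => [_|]; [rewrite -EFinB; congr EFin; ring|
      rewrite -leNgt => ?; congr EFin; lra].
  move=> x; rewrite inE/= in_itv/= /uniform_pdf => /andP[x0 x1].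
  by rewrite subr0 invr1 ifT//; apply/andP; split; lra.
have mI : measurable ([set` `[0, 1[ ] : set R) by exact: measurable_itv.
have unif01 : unif [set` `[0, 1[ ] = 1%E.
  by rewrite -[X in `[0, X[]add0r unif_itv//; lra.
rewrite (measureDI unif mE mI) [X in (X + _)%E](_ : _ = 0%E).
  rewrite add0e (_ : E `&` _ = [set` `[a, a + l[ ]); first exact: unif_itv.
  by rewrite -aE; apply/seteqP; split => x /=; rewrite in_itv/= => -[].
apply/eqP; rewrite eq_le measure_ge0 andbT.
apply: (@le_trans _ _ (unif (~` [set` `[0, 1[ ]))).
  by apply: le_measure; rewrite ?inE//; [exact: measurableD|exact: measurableC].
by rewrite probability_setC// [X in (_ - X)%E]unif01 subee.
Qed.

Lemma uniform_digits_event (n : nat) (A : nat -> set bool) :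
  unif [set x | forall k, (k < n)%N -> A k (digit k x)] =
  (\prod_(0 <= k < n) bernoulli_prob p (A k))%E.
Proof.
pose r k : R := p * (true \in A k)%:R + (1 - p) * (false \in A k)%:R.
have rE k : bernoulli_prob p (A k) = (r k)%:E.
  by rewrite bernoulli_probE// !diracE.
pose E m (b : nat -> bool) j := [set x : R |
  (forall k, (k < m)%N -> digit k x = b k) /\
  (forall k, (m <= k < m + j)%N -> A k (digit k x))].
have mE m b j : measurable (E m b j).
  rewrite (_ : E m b j = \bigcap_(k in `I_m) (digit k @^-1` [set b k]) `&`
      \bigcap_(k in [set k | (m <= k < m + j)%N]) (digit k @^-1` A k)) //.
  by apply: measurableI; apply: bigcap_measurableType => k _;
    rewrite -[X in measurable X]setTI; exact: measurable_digit.
suff {n} claim j : forall m b, unif (E m b j) =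
    ((\prod_(k < m) weight (b k)) * \prod_(m <= k < m + j) r k)%:E.
  transitivity (unif (E 0 xpredT n)).
    by congr (unif _); apply/seteqP; split => x /=; [move=> h; split|case].
  by rewrite claim big_ord0 mul1r (eq_bigr _ (fun k _ => rE k)) -prodEFin.
elim: j => [|j IHj] m b.
  rewrite addn0 big_geq// mulr1 -uniform_digits; congr (unif _).
  by apply/seteqP; split => x /=; [case|move=> h; split => // k; lia].
pose bb c k := if k == m then c else b k.
have mD : measurable (digit m @^-1` [set true]).
  by rewrite -[X in measurable X]setTI; exact: measurable_digit.
have Ec c : E m b j.+1 `&` (digit m @^-1` [set c]) =
    if c \in A m then E m.+1 (bb c) j else set0.
  apply/seteqP; split => [x /= [[xb xA] xc]|x].
    have -> : c \in A m by rewrite inE -xc; apply: xA; lia.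
    split=> k km; last by apply: xA; lia.
    by rewrite /bb; case: eqP => [->//|?]; apply: xb; lia.
  case: ifPn => // /set_mem cA [xb xA]; have xc : digit m x = c.
    by rewrite xb// /bb eqxx.
  split=> //; split=> k km.
    by rewrite xb ?/bb; [case: eqP => // ?; lia|lia].
  have [->|kNm] := eqVneq k m; first by rewrite xc.
  by apply: xA; lia.
have muc c : unif (E m b j.+1 `&` (digit m @^-1` [set c])) =
    ((\prod_(k < m) weight (b k)) * (weight c * (c \in A m)%:R) *
     \prod_(m.+1 <= k < m.+1 + j) r k)%:E.
  rewrite Ec; case: ifPn => _; last by rewrite measure0 !mulr0 mul0r.
  rewrite IHj big_ord_recr/= {2}/bb eqxx mulr1; congr (_ * _ * _)%:E.
  by apply: eq_bigr => i _; rewrite /bb ltn_eqF.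
rewrite (measureDI unif (mE _ _ _) mD).
rewrite (_ : E m b j.+1 `\` (digit m @^-1` [set true]) = E m b j.+1 `&` (digit m @^-1` [set false])).
  rewrite [X in (X + _)%E]muc [X in (_ + X)%E]muc -EFinD; congr EFin.
  rewrite [in RHS]big_ltn; last lia.
  by rewrite addSnnS /r /weight; ring.
apply/seteqP; split=> x /= [xE xd]; split=> //; last by rewrite xd.
by apply/negbTE/negP.
Qed.

Lemma iid_bernoulli_exists01 (I : countType) :
  exists mu : probability (configuration I) R, iid_bernoulli p mu.
Proof.
pose f (x : measurableTypeR R) : configuration I := fun i => digit (choice.pickle i) x.
have mf : measurable_fun (setT : set (measurableTypeR R)) f.
  apply: (@measurability _ _ _ (configuration I) setT f (@coordinate_events I) erefl).
  move=> _ [_ [i [B ->]] <-]; rewrite setTI.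
  rewrite (_ : _ @^-1` _ = digit (choice.pickle i) @^-1` B)//.
  by rewrite -[X in measurable X]setTI; exact: measurable_digit.
pose fm : {mfun measurableTypeR R >-> configuration I} := mfun_Sub (mem_set mf).
exists (distribution unif fm) => S A.
pose t := [seq choice.pickle i | i <- S].
pose A' k := if @choice.pickle_inv I k is Some i then
  (if i \in S then A i else setT) else setT.
have A'E i : i \in S -> A' (choice.pickle i) = A i.
  by rewrite /A' choice.pickleK_inv => ->.
have A'T k : k \notin t -> A' k = setT.
  rewrite /A'; case ki : (choice.pickle_inv k) => [i|//] kt; case: ifPn => // iS.
  case/negP: kt; have := @choice.pickle_invK I k; rewrite /oapp ki => <-.
  exact: map_f.
pose n := (\max_(k <- t) k).+1.
have tn k : k \in t -> (k < n)%N.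
  by move=> kt; rewrite ltnS; rewrite (big_rem k kt) leq_maxl.
transitivity (unif [set x | forall k, (k < n)%N -> A' k (digit k x)]).
  congr (unif _); apply/seteqP; split => x /= h.
    move=> k _; have [/mapP[i iS ->]|kt] := boolP (k \in t).
      by rewrite A'E//; exact: h.
    by rewrite A'T.
  by move=> i iS; rewrite -A'E//; apply/h/tn/map_f.
rewrite uniform_digits_event (bigID (mem t))/= [X in (_ * X)%E]big1 ?mule1.
  rewrite -big_filter (perm_big t).
    by rewrite big_map; apply: eq_big_seq => i iS; rewrite A'E.
  apply: uniq_perm.
  - by rewrite filter_uniq// iota_uniq.
  - by rewrite map_inj_uniq ?fset_uniq//; exact: (pcan_inj choice.pickleK).
  - by move=> k; rewrite mem_filter mem_index_iota/=; case: (boolP (k \in t)) => //= /tn ->.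
by move=> k kt; rewrite A'T// probability_setT.
Qed.

End digits.

Lemma iid_bernoulli_exists (R : realType) (I : countType) (q : R) :
  exists mu : probability (configuration I) R, iid_bernoulli q mu.
Proof.
have [q01|q01] := boolP (0 <= q <= 1); first exact: iid_bernoulli_exists01.
have p0 : 0 <= (0 : R) <= 1 by rewrite lexx ler01.
have [mu mu0] := iid_bernoulli_exists01 p0 I.
exists mu => S A; rewrite mu0; apply: eq_bigr => i _.
by rewrite bernoulli_probE// /bernoulli_prob (negbTE q01) mul0e
  add0e unstable.onem0 mul1e.
Qed.

(* This determines [bernoulli_measure I q] uniquely: the events in
   [iid_bernoulli] form a pi-system generating the sigma-algebra. *)
Definition bernoulli_measure (R : realType) (I : countType) (q : R) :
  probability (configuration I) R := sval (cid (iid_bernoulli_exists I q)).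

Lemma bernoulli_measureP (R : realType) (I : countType) (q : R) :
  iid_bernoulli q (bernoulli_measure I q).
Proof. by rewrite /bernoulli_measure; case: cid. Qed.

Section bootstrap_percolation.
Context (d : nat).
Local Notation site := 'rV[int]_d.

Definition update_family (F : {fset {fset site}}) : Prop :=
  forall X, X \in F -> 0 \notin X.

Definition in_half_space (R : realType) (F : {fset {fset site}}) : Prop :=
  exists u : 'rV[R]_d, forall X, X \in F -> forall x, x \in X ->
    \sum_(i < d) (x 0 i)%:~R * u 0 i < 0.

Definition bp_step (F : {fset {fset site}}) (w : site -> bool) : site -> bool :=
  fun x => w x || [exists X : F, [forall y : fsval X, w (x + fsval y)]].

(* The initial configuration [w] is the state at time -1. *)
Definition bp (F : {fset {fset site}}) (w : site -> bool) (t : nat) :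
  site -> bool := iter t.+1 (bp_step F) w.

Definition healthy_at_origin (F : {fset {fset site}}) (t : nat) :
  set (configuration site) := [set w | bp F w t 0 <> true].

Definition qc (R : realType) (F : {fset {fset site}}) : R :=
  inf [set q : R | 0 <= q <= 1 /\
    bernoulli_measure site q (healthy_at_origin F t) @[t --> \oo] --> 0%E].

End bootstrap_percolation.

(* Main.v *)
Require Import Defs.
From mathcomp Require Import all_boot all_order all_algebra finmap.
From mathcomp Require Import all_classical all_reals all_analysis.
From mathcomp Require Import zify ring lra.

Set Implicit Arguments.
Unset Strict Implicit.
Unset Printing Implicit Defensive.
Import Order.TTheory GRing.Theory Num.Theory.
Import numFieldNormedType.Exports.
Local Open Scope classical_set_scope.
Local Open Scope ring_scope.

(* Let theta n be the probability that the origin stays healthy when the sites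
   at height more than n are healthy forever, the height being an integral
   linear form with values in [1, M] on the update sets. The probability that
   the origin is healthy at time t is between theta (M (t + 1)) and theta t.
   For each k < n, the event of theta n is decided by exploring first the sites
   of height at most k, downwards from height k, and never revealing a site
   once it or the origin is known to get infected. A site x is then revealed
   with probability at most theta (k - height x) / p or theta k, so that the
   OSSS inequality, averaged over k, and Russo's formula give, in the
   probability p = 1 - q of an initially healthy site,
     n theta_n (1 - theta_n) <= 2 (theta_0 + ... + theta_(n-1)) theta_n',
   and the Duminil-Copin-Raoufi-Tassion argument concludes. *)

(** * Sharp threshold from the differential inequality *)

Lemma derive_ge_increment (R : realType) (f df : R -> R) (m a b : R) :
  a <= b -> (forall x : R, is_derive x 1 f (df x)) ->
  (forall x, a <= x <= b -> m <= df x) -> m * (b - a) <= f b - f a.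
Proof.
move=> ab fdf mdf.
have cf : {within `[a, b], continuous f}.
  apply: derivable_within_continuous => x _; exact: (@ex_derive _ _ _ _ _ _ _ (fdf x)).
have [c] := MVT_segment ab (fun x _ => fdf x) cf.
by rewrite in_itv/= => /mdf mc ->; rewrite ler_wpM2r// subr_ge0.
Qed.

(** With the integrating factor [expR (- m * x)], the hypothesis says that [g] has a nonnegative
    derivative on [[a, b]]. *)
Lemma gronwall (R : realType) (f df : R -> R) (m a b : R) :
  a <= b -> (forall x : R, is_derive x 1 f (df x)) ->
  (forall x, a <= x <= b -> m * f x <= df x) ->
  f a <= f b * expR (- (m * (b - a))).
Proof.
move=> ab fdf mdf; pose g := fun x : R => f x * expR (- m * x).
pose dg := fun x : R => expR (- m * x) * (df x - m * f x).
have gdg (x : R) : is_derive x 1 g (dg x).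
  have e : is_derive x 1 (fun x : R => expR (- m * x)) (expR (- m * x) * - m).
    apply: (@is_derive1_comp _ expR (fun x : R => - m * x)).
    by apply: is_derive_eq; rewrite /GRing.scale/= mulr1.
  have h := is_deriveM (fdf x) e.
  by apply: is_derive_eq; rewrite /dg /GRing.scale/=; ring.
have := @derive_ge_increment _ g dg 0 a b ab gdg.
rewrite mul0r subr_ge0 => H.
have gab : g a <= g b.
  by apply: H => x xab; rewrite /dg mulr_ge0 ?expR_ge0// subr_ge0 mdf.
have -> : f a = g a * expR (m * a).
  by rewrite /g -mulrA -expRD mulNr addNr expR0 mulr1.
rewrite (_ : - (m * (b - a)) = - m * b + m * a); last by ring.
by rewrite expRD mulrA ler_wpM2r ?expR_ge0.
Qed.

Section sharp_threshold.
Context (R : realType) (f df : nat -> R -> R).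
(** The summand 1 makes [A n x] at least 1 on [[0, 1]], so that its logarithm and its inverse make
    sense. *)
Local Notation A n x := (1 + \sum_(0 <= j < n) f j x).

Hypothesis fdf : forall n (x : R), is_derive x 1 (f n) (df n x).
Hypothesis f01 : forall n x, 0 <= x <= 1 -> 0 <= f n x <= 1.
Hypothesis df0 : forall n x, 0 <= x <= 1 -> 0 <= df n x.
Hypothesis diff_ineq : forall n x, 0 <= x <= 1 ->
  n%:R * (f n x * (1 - f n x)) <= 2 * A n x * df n x.

Let f_mono n x y : 0 <= x -> x <= y -> y <= 1 -> f n x <= f n y.
Proof.
move=> x0 xy y1.
have := @derive_ge_increment _ (f n) (df n) 0 x y xy (fdf n).
rewrite mul0r subr_ge0; apply => z /andP[xz zy]; apply: df0.
by apply/andP; split; lra.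
Qed.

Let A_ge1 n x : 0 <= x <= 1 -> 1 <= A n x.
Proof.
move=> x01; rewrite lerDl; apply: sumr_ge0 => i _.
by have /andP[] := f01 i x01.
Qed.

Let A_mono n x y : 0 <= x -> x <= y -> y <= 1 -> A n x <= A n y.
Proof. by move=> *; rewrite lerD2l; apply: ler_sum => i _; exact: f_mono. Qed.

(** * Bootstrapping: a square-root bound on [A n], a uniform one, exponential decay *)

Section below.
Context (b eps : R) (n0 : nat).
Hypothesis b01 : 0 <= b <= 1.
Hypothesis n0_gt0 : (0 < n0)%N.
Hypothesis eps2 : eps <= 2^-1.
Hypothesis feps : forall n, (n0 <= n)%N -> f n b <= eps.

(** Below [b] the factor [1 - f n x] is at least 1/2, which doubles the constant of [diff_ineq]. *)
Let log_derivative n x : (n0 <= n)%N -> 0 <= x <= b ->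
  n%:R * f n x <= 4 * A n x * df n x.
Proof.
move=> nn0 /andP[x0 xb]; have /andP[b0 b1] := b01.
have x01 : 0 <= x <= 1 by apply/andP; split; lra.
have := diff_ineq n x01; have /andP[f0 f1] := f01 n x01.
have fx2 : f n x <= 2^-1.
  by apply: le_trans eps2; apply: le_trans (feps nn0); exact: f_mono.
have n_ge0 : 0 <= n%:R * f n x :> R by rewrite mulr_ge0.
have : n%:R * f n x * 2^-1 <= n%:R * f n x * (1 - f n x).
  by rewrite ler_wpM2l//; lra.
by rewrite mulrA; lra.
Qed.

Let exp_decay n x y K : (n0 <= n)%N -> 0 <= x -> x <= y -> y <= b ->
  A n y <= K -> f n x <= expR (- ((y - x) / (4 * K) * n%:R)).
Proof.
move=> nn0 x0 xy yb AK; have /andP[b0 b1] := b01.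
have K1 : 1 <= K by apply: le_trans AK; apply: A_ge1; apply/andP; split; lra.
have K0 : 0 < 4 * K by lra.
have := @gronwall _ (f n) (df n) (n%:R / (4 * K)) x y xy (fdf n).
rewrite (_ : n%:R / _ * (y - x) = (y - x) / (4 * K) * n%:R); last by ring.
move=> H; apply: (le_trans (H _)).
  move=> z /andP[xz zy]; rewrite mulrAC ler_pdivrMr// mulrC [leRHS]mulrC.
  have z01 : 0 <= z <= 1 by apply/andP; split; lra.
  rewrite [f n z * _]mulrC; apply: le_trans (log_derivative nn0 _) _.
    by apply/andP; split; lra.
  rewrite ler_wpM2r ?df0// ler_wpM2l//; apply: le_trans AK.
  by apply: A_mono => //; lra.
rewrite ler_piMl ?expR_ge0//.
by have /andP[] : 0 <= f n y <= 1 by apply: f01; apply/andP; split; lra.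
Qed.

Let ln_ratio (x y : R) : 0 < x -> 0 < y -> ln y - ln x <= (y - x) / x.
Proof.
move=> x0 y0; rewrite -ln_div ?posrE//.
rewrite (_ : y / x = 1 + (y - x) / x); last by field; lra.
apply: le_ln1Dx; rewrite -subr_gt0 (_ : _ - _ = y / x) ?divr_gt0//.
by field; lra.
Qed.

(** [T] sums the [f i] with logarithmic weights. Since [f i / A i] dominates the increment of
    [ln (A i)], the lower bound on the derivative of [T] telescopes to a multiple of [ln (A n)],
    while [T b] is at most [eps] times a harmonic sum. Integrating from [x] to [b] compares the
    two. *)
Let ln_A_le n x : (n0 <= n)%N -> 0 <= x -> x <= b ->
  ln (A n x) * (b - x) <= ln (1 + n0%:R) * (b - x) + 8 * eps * ln n%:R.
Proof.
move=> nn0 x0 xb; have /andP[b0 b1] := b01.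
have eps0 : 0 <= eps.
  by apply: le_trans (feps (leqnn _)); have /andP[] := f01 n0 b01.
pose T (y : R) := \sum_(n0 <= i < n) (i.+1%:R)^-1 * f i y.
pose dT (y : R) := \sum_(n0 <= i < n) (i.+1%:R)^-1 * df i y.
have TdT (y : R) : is_derive y 1 T (dT y).
  rewrite /T /dT {T dT}; elim: {nn0}n => [|k IHk].
    under eq_fun do rewrite big_geq//; rewrite big_geq//; exact: is_derive_cst.
  have [kn0|kn0] := leqP n0 k; last first.
    under eq_fun do rewrite big_geq//; rewrite big_geq//; exact: is_derive_cst.
  under eq_fun do rewrite big_nat_recr//=; rewrite big_nat_recr//=.
  by apply: is_deriveD; apply: is_deriveZ.
have dT_ge y : x <= y <= b -> 8^-1 * (ln (A n x) - ln (1 + n0%:R)) <= dT y.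
  move=> /andP[xy yb]; have y01 : 0 <= y <= 1 by apply/andP; split; lra.
  have Apos k z : 0 <= z <= 1 -> 0 < A k z.
    by move=> z01; apply: lt_le_trans (A_ge1 k z01).
  apply: (@le_trans _ _ (8^-1 * (ln (A n y) - ln (A n0 y)))).
    rewrite ler_wpM2l// lerB//.
      by rewrite ler_ln ?posrE ?Apos//; [apply: A_mono => //; lra|apply/andP; split; lra].
    have q0 : 0 < 1 + n0%:R :> R by rewrite ltr_pwDl.
    rewrite ler_ln ?posrE ?Apos// lerD2l (_ : n0%:R = \sum_(0 <= j < n0) 1).
      by apply: ler_sum => i _; have /andP[] := f01 i y01.
    by rewrite big_const_nat subn0 iter_addr addr0.
  rewrite -(telescope_sumr (fun i => ln (A i y)) nn0) mulr_sumr.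
  rewrite /dT !big_nat; apply: ler_sum => i /andP[n0i _].
  have i1 : 1 <= i%:R :> R by rewrite ler1n; exact: leq_trans n0i.
  have Ai := Apos i y y01.
  have h1 : ln (A i.+1 y) - ln (A i y) <= f i y / A i y.
    apply: le_trans (ln_ratio Ai (Apos i.+1 y y01)) _.
    by rewrite big_nat_recr//= addrA [1 + _ + _ - _]addrC addKr.
  have h2 : i%:R * (f i y / A i y) <= 4 * df i y.
    rewrite mulrA ler_pdivrMr//; have := @log_derivative i y n0i.
    by rewrite mulrAC; apply; apply/andP; split; lra.
  have h3 : 0 <= f i y / A i y.
    by rewrite divr_ge0 ?(ltW Ai)//; have /andP[] := f01 i y01.
  (* The 8 is the 4 of [log_derivative] times the 2 of [i + 1 <= 2 * i]. *)
  apply: le_trans (_ : 8^-1 * (f i y / A i y) <= _); first by rewrite ler_wpM2l.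
  rewrite [leRHS]mulrC ler_pdivlMr ?ltr0n// -[i.+1]addn1 natrD.
  move: h2 h3; set u := f i y / _ => h2 h3. nra.
have Tb : T b <= eps * ln n%:R.
  apply: (@le_trans _ _ (\sum_(n0 <= i < n) eps * (ln i.+1%:R - ln i%:R))).
    rewrite /T !big_nat; apply: ler_sum => i /andP[n0i _].
    have i0 : 0 < i%:R :> R by rewrite ltr0n; exact: leq_trans n0i.
    have i1 : 0 < i.+1%:R :> R by [].
    rewrite mulrC ler_pM ?invr_ge0 ?(ltW i1) ?feps//.
      by have /andP[] := f01 i b01.
    have := ln_ratio i1 i0.
    rewrite -[i.+1]addn1 natrD (_ : (i%:R - _) = -1); last by ring.
    by rewrite mulN1r; lra.
  rewrite -mulr_sumr telescope_sumr// ler_wpM2l// lerBlDr lerDl.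
  by apply: ln_ge0; rewrite ler1n.
have Tx : 0 <= T x.
  apply: sumr_ge0 => i _; rewrite mulr_ge0 ?invr_ge0//.
  by have /andP[] : 0 <= f i x <= 1 by apply: f01; apply/andP; split; lra.
have := derive_ge_increment xb TdT dT_ge.
by move: (ln (A n x)) (ln (1 + _)) (ln n%:R) Tb => u v w; lra.
Qed.

(** The choice of [eps] makes [8 * eps / (b - x)], the power of [n] allowed by [ln_A_le], at most
    1/2. *)
Let A_le_sqrt n x : (n0 <= n)%N -> 0 <= x -> x < b -> eps <= (b - x) / 16 ->
  A n x <= (1 + n0%:R) * Num.sqrt n%:R.
Proof.
move=> nn0 x0 xb epsx; have /andP[b0 b1] := b01.
have Apos : 0 < A n x.
  by apply: lt_le_trans (A_ge1 _ _) => //; apply/andP; split; lra.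
have n_gt0 : 0 < n%:R :> R by rewrite ltr0n; exact: leq_trans nn0.
have ln0 : 0 <= ln n%:R :> R by apply: ln_ge0; rewrite ler1n -(@ltr0n R).
have s0 : 0 < Num.sqrt n%:R :> R by rewrite sqrtr_gt0.
have q0 : 0 < 1 + n0%:R :> R by rewrite ltr_pwDl.
have lns : ln n%:R = 2 * ln (Num.sqrt n%:R) :> R.
  by rewrite -{1}[n%:R](@sqr_sqrtr R) ?ltW// lnXn// mulr2n mulrDl mul1r.
rewrite -ler_ln ?posrE ?mulr_gt0// lnM ?posrE//.
have := ln_A_le nn0 x0 (ltW xb); rewrite lns in ln0 *.
move: (ln (A n x)) (ln (1 + _)) (ln (Num.sqrt _)) ln0 => u v w w0 h.
rewrite -(@ler_pM2r _ (b - x)); last by rewrite subr_gt0.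
nra.
Qed.

(** The square-root bound applies at the midpoint [y], where [(b - y) / 16] is [(b - x) / 32]. Then
    [exp_decay] from [x] to [y] bounds [f n x] by an exponential in [- sqrt n], which is
    summable. *)
Let A_bounded x : 0 <= x -> x < b -> eps <= (b - x) / 32 ->
  exists K, forall n, A n x <= K.
Proof.
move=> x0 xb epsx; have /andP[b0 b1] := b01.
pose y := (x + b) / 2.
have xy : x < y by rewrite /y; lra.
have yb : y < b by rewrite /y; lra.
pose k := (y - x) / (4 * (1 + n0%:R)).
have q0 : 0 < 1 + n0%:R :> R by rewrite ltr_pwDl.
have k0 : 0 < k by rewrite divr_gt0 ?mulr_gt0 ?subr_gt0.
have fk n : (n0 <= n)%N -> f n x <= (k / 4) ^- 4 * (n%:R ^- 2).
  move=> nn0.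
  have n_gt0 : 0 < n%:R :> R by rewrite ltr0n; exact: leq_trans nn0.
  have s0 : 0 < Num.sqrt n%:R :> R by rewrite sqrtr_gt0.
  have As : A n y <= (1 + n0%:R) * Num.sqrt n%:R.
    by apply: A_le_sqrt => //; rewrite /y; lra.
  apply: le_trans (exp_decay nn0 x0 (ltW xy) (ltW yb) As) _.
  (* For [s = k / 4 * sqrt n], the bound [s <= expR s] gives [expR (- (4 * s)) <= s ^- 4], a
     multiple of [n ^- 2]. *)
  have -> : (y - x) / (4 * ((1 + n0%:R) * Num.sqrt n%:R)) * n%:R =
      4%:R * (k / 4 * Num.sqrt n%:R).
    rewrite -{2}[n%:R](@sqr_sqrtr R) ?ltW// /k; field.
    by rewrite !gt_eqF.
  have -> : (k / 4) ^- 4 * n%:R ^- 2 = ((k / 4 * Num.sqrt n%:R) ^+ 4)^-1.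
    have -> : n%:R ^+ 2 = Num.sqrt n%:R ^+ 4 :> R.
      by rewrite -[in LHS](@sqr_sqrtr R n%:R) ?ltW// -exprM.
    by rewrite -invfM -exprMn.
  have ks0 : 0 < k / 4 * Num.sqrt n%:R by apply: mulr_gt0 => //; apply: divr_gt0.
  rewrite expRN expRM_natl lef_pV2 ?posrE ?exprn_gt0 ?expR_gt0//.
  rewrite lerXn2r ?nnegrE ?expR_ge0 ?(ltW ks0)//.
  by apply: le_trans (expR_ge1Dx _); rewrite lerDr.
set D := (k / 4) ^- 4 in fk.
have D0 : 0 <= D by rewrite invr_ge0 exprn_ge0// divr_ge0 ?ltW.
have sum_small n : (n <= n0)%N -> \sum_(0 <= j < n) f j x <= n0%:R.
  move=> nn0; apply: (@le_trans _ _ (\sum_(0 <= j < n) 1)).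
    apply: ler_sum => i _.
    by have /andP[] : 0 <= f i x <= 1 by apply: f01; apply/andP; split; lra.
  by rewrite big_const_nat subn0 iter_addr addr0 ler_nat.
have sum_large n : (n0 <= n)%N ->
    \sum_(0 <= j < n) f j x <= n0%:R + 2 * D * (n0%:R^-1 - n%:R^-1).
  elim: n => [|n IHn]; first by rewrite leqn0 => /eqP n00; move: n0_gt0; rewrite n00.
  rewrite leq_eqVlt => /orP[/eqP <-|n0n].
    by rewrite subrr mulr0 addr0 sum_small.
  rewrite big_nat_recr//=; have := IHn n0n; have := fk n n0n.
  have n_gt0 : 1 <= n%:R :> R by rewrite ler1n; exact: (leq_trans n0_gt0).
  have : n%:R ^- 2 <= 2 * (n%:R^-1 - n.+1%:R^-1) :> R.
    rewrite -[n.+1]addn1 natrD.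
    rewrite (_ : n%:R^-1 - _ = (n%:R * (n%:R + 1))^-1); last by field; lra.
    have n_pos : 0 < n%:R :> R by lra.
    rewrite ler_pdivlMr ?mulr_gt0 ?ltr_wpDr// mulrC ler_pdivrMr ?exprn_gt0//.
    by move: (n%:R) n_gt0 => m m1; nra.
  move=> /(ler_wpM2l D0).
  by move: (n%:R ^- 2) (n%:R^-1) (n.+1%:R^-1) (n0%:R^-1) => u v w z; lra.
exists (1 + (n0%:R + 2 * D)) => n; rewrite lerD2l.
have [nn0|nn0] := leqP n n0.
  by apply: le_trans (sum_small _ nn0) _; lra.
apply: le_trans (sum_large _ (ltnW nn0)) _; rewrite lerD2l ler_piMr ?mulr_ge0//.
have : n0%:R^-1 <= 1 :> R by rewrite invf_le1 ?ltr0n// ler1n.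
have : 0 <= n%:R^-1 :> R by rewrite invr_ge0.
lra.
Qed.

(** The interval is halved once more: [A n] is bounded at the midpoint [x] uniformly in [n], so the
    exponent in [exp_decay] from [a] to [x] is linear in [n]. *)
Lemma exponential_decay_below a : 0 <= a -> a < b -> eps <= (b - a) / 64 ->
  exists c C : R, [/\ 0 < c, 0 < C & forall n, f n a <= C * expR (- (c * n%:R))].
Proof.
move=> a0 ab epsa; have /andP[b0 b1] := b01.
pose x := (a + b) / 2.
have [K AK] : exists K, forall n, A n x <= K.
  by apply: A_bounded; rewrite /x; lra.
have ax : a <= x by rewrite /x; lra.
have K1 : 1 <= K.
  by apply: le_trans (AK 0); apply: A_ge1; apply/andP; split; rewrite /x; lra.
pose c := (x - a) / (4 * K).
have c0 : 0 < c by rewrite divr_gt0//; rewrite /x; lra.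
(* This constant makes the bound at least 1 for [n < n0]. *)
exists c, (expR (c * n0%:R)); split => [//||n]; first exact: expR_gt0.
have [nn0|nn0] := leqP n0 n.
  apply: (@le_trans _ _ (expR (- (c * n%:R)))).
    by apply: exp_decay => //; rewrite /x; lra.
  by rewrite ler_peMl ?expR_ge0// -[leLHS]expR0 ler_expR mulr_ge0// ltW.
apply: (@le_trans _ _ 1).
  by have /andP[] : 0 <= f n a <= 1 by apply: f01; apply/andP; split; lra.
rewrite -expRD -[leLHS]expR0 ler_expR -mulrBr mulr_ge0 ?subr_ge0 ?ltW//.
by rewrite ltr_nat.
Qed.

End below.

Lemma exponential_decay a b : 0 <= a -> a < b -> b <= 1 ->
  f n b @[n --> \oo] --> 0 ->
  exists c C : R, [/\ 0 < c, 0 < C & forall n, f n a <= C * expR (- (c * n%:R))].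
Proof.
move=> a0 ab b1 fb.
pose eps : R := (b - a) / 64.
have eps0 : 0 < eps by rewrite /eps; lra.
have b01 : 0 <= b <= 1 by apply/andP; split; lra.
have [n0 _ Hn0] : \forall n \near \oo, f n b <= eps.
  move/cvgrPdist_le : fb => /(_ eps eps0); apply: filterS => n.
  by rewrite sub0r normrN; apply: le_trans; exact: ler_norm.
apply: (@exponential_decay_below b eps n0.+1) => //.
- by rewrite /eps; lra.
- by move=> n nn0; apply: Hn0 => /=; exact: ltnW.
Qed.

End sharp_threshold.

(** * Russo's formula and the OSSS inequality *)

Definition upd (I : eqType) (w : I -> bool) (x : I) (b : bool) : I -> bool :=
  fun y => if y == x then b else w y.

Lemma upd_same (I : eqType) (w : I -> bool) x b c :
  upd (upd w x b) x c = upd w x c.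
Proof. by apply/funext => y; rewrite /upd; case: eqP. Qed.

Lemma updC (I : eqType) (w : I -> bool) x y b c : x != y ->
  upd (upd w x b) y c = upd (upd w y c) x b.
Proof.
move=> xy; apply/funext => z; rewrite /upd.
by have [->|//] := eqVneq z y; rewrite eq_sym (negbTE xy).
Qed.

Section mean.
Context (R : realType) (I : eqType).
Implicit Types (p : R) (f g : (I -> bool) -> R) (w : I -> bool) (s : seq I).

(* In a percolation setting it is natural to increase the probability of the
   monitored event, so [p] is the probability of the state [false]. *)
Definition avg p (x : I) f : (I -> bool) -> R :=
  fun w => p * f (upd w x false) + (1 - p) * f (upd w x true).

(** Sites outside [s] keep their state in the last argument, so that expectations are finite sums,
    computed one site at a time. *)
Definition mean p s f : (I -> bool) -> R := foldr (avg p) f s.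

Definition gap (x : I) f : (I -> bool) -> R :=
  fun w => f (upd w x false) - f (upd w x true).

Definition ignores (x : I) f := forall w b, f (upd w x b) = f w.

Lemma avg_ignores p x f : ignores x f -> avg p x f = f.
Proof. by move=> h; apply/funext => w; rewrite /avg !h; ring. Qed.

Lemma ignores_avg p x f : ignores x (avg p x f).
Proof. by move=> w b; rewrite /avg !upd_same. Qed.

Lemma ignores_gap x f : ignores x (gap x f).
Proof. by move=> w b; rewrite /gap !upd_same. Qed.

Lemma avgC p x y f : avg p x (avg p y f) = avg p y (avg p x f).
Proof.
have [->//|xy] := eqVneq x y.
by apply/funext => w; rewrite /avg !(@updC _ w x y)//; ring.
Qed.

Lemma avg_gap p x y f : x != y -> avg p x (gap y f) = gap y (avg p x f).
Proof.
by move=> xy; apply/funext => w; rewrite /avg /gap !(@updC _ w x y)//; ring.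
Qed.

Lemma mean_gap p s y f : y \notin s -> mean p s (gap y f) = gap y (mean p s f).
Proof.
elim: s => //= x s IHs; rewrite inE negb_or eq_sym => /andP[xy /IHs ->].
exact: avg_gap.
Qed.

Lemma mean_avg_comm p s x f : mean p s (avg p x f) = avg p x (mean p s f).
Proof. by elim: s => //= y s ->; rewrite avgC. Qed.

(** Averages at different sites commute, and averaging twice at [x] is averaging once. *)
Lemma mean_avg p s x f : x \in s -> mean p s (avg p x f) = mean p s f.
Proof.
elim: s => //= y s IHs; rewrite inE => /predU1P[<-|/IHs ->//].
by rewrite mean_avg_comm avg_ignores//; exact: ignores_avg.
Qed.

Lemma mean_lin p s (a b : R) f g w :
  mean p s (fun w => a * f w + b * g w) w = a * mean p s f w + b * mean p s g w.
Proof.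
elim: s w => //= x s IHs w; rewrite /avg !IHs; ring.
Qed.

Lemma meanZ p s (a : R) f w : mean p s (fun w => a * f w) w = a * mean p s f w.
Proof. by elim: s w => //= x s IHs w; rewrite /avg !IHs; ring. Qed.

Lemma meanD p s f g w : mean p s (fun w => f w + g w) w = mean p s f w + mean p s g w.
Proof. by elim: s w => //= x s IHs w; rewrite /avg !IHs; ring. Qed.

Lemma mean_cst p s (a : R) w : mean p s (fun=> a) w = a.
Proof. by elim: s w => //= x s IHs w; rewrite /avg !IHs; ring. Qed.

Lemma mean_cond p s x (H : bool -> (I -> bool) -> R) w : x \in s ->
  (forall b, ignores x (H b)) ->
  mean p s (fun w => H (w x) w) w =
  p * mean p s (H false) w + (1 - p) * mean p s (H true) w.
Proof.
move=> xs Hx; rewrite -mean_lin -(mean_avg p _ xs); congr (mean p s _ w).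
by apply/funext => w'; rewrite /avg /upd eqxx -!/(upd _ _ _) !Hx.
Qed.

Lemma le_mean p s f g w : 0 <= p <= 1 -> (forall w, f w <= g w) ->
  mean p s f w <= mean p s g w.
Proof.
move=> /andP[p0 p1] fg; elim: s w => //= x s IHs w.
by rewrite lerD// ler_wpM2l// subr_ge0.
Qed.

Lemma mean_ge0 p s f w : 0 <= p <= 1 -> (forall w, 0 <= f w) -> 0 <= mean p s f w.
Proof. by move=> p01 f0; rewrite -(mean_cst p s 0 w) le_mean. Qed.

Lemma mean_le1 p s f w : 0 <= p <= 1 -> (forall w, f w <= 1) -> mean p s f w <= 1.
Proof. by move=> p01 f0; rewrite -(mean_cst p s 1 w) le_mean. Qed.

(** Russo's formula. In the product rule for the average at [x], differentiating the weights [p] and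
    [1 - p] gives the gap at [x]; the other terms are the averaged derivatives for the tail. *)
Lemma is_derive_mean s f w (p : R) : uniq s ->
  is_derive p 1 (fun p => mean p s f w) (\sum_(x <- s) mean p s (gap x f) w).
Proof.
elim: s w => [|x s IHs] w /=.
  by rewrite big_nil => _; exact: is_derive_cst.
move=> /andP[xs us].
pose h b p := mean p s f (upd w x b).
pose dh b p := \sum_(y <- s) mean p s (gap y f) (upd w x b).
have hdh b : is_derive p 1 (h b) (dh b p) by exact: IHs.
have d1 := is_deriveM (is_derive_id p 1) (hdh false).
have dq : is_derive p 1 (fun p : R => 1 - p) (-1).
  by apply: is_derive_eq; rewrite add0r mul1r.
have d2 := is_deriveM dq (hdh true).
have := is_deriveD d1 d2.
rewrite (_ : _ + _ = (fun p => mean p (x :: s) f w)); last exact/funext.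
move=> d; apply: is_derive_eq.
rewrite big_cons -[_ + \sum_(_ <- _) _]/(avg p x (mean p s (gap x f)) w + _).
rewrite mean_gap// (avg_ignores _ (@ignores_gap x _)).
under [in RHS]eq_bigr do rewrite /avg.
rewrite big_split/= -!mulr_sumr /GRing.scale/= /gap -/(dh false p) -/(dh true p).
rewrite -/(h false p) -/(h true p) /=.
by ring.
Qed.

End mean.

Section osss.
Context (R : realType) (I : eqType) (T : Type).
Context (skip : T -> I -> bool) (reveal : T -> I -> bool -> T) (res : T -> R).
Implicit Types (w : I -> bool) (v : T) (l s : seq I).

(* An adaptive exploration: the sites of l are considered in order, and [skip]
   decides from what was seen so far whether the next one is left unrevealed. *)
Definition explore v l w : T :=
  foldl (fun v x => if skip v x then v else reveal v x (w x)) v l.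

Definition reveals v l x w : bool :=
  ~~ skip (explore v (take (index x l) l) w) x.

Lemma explore_upd v l x w b : x \notin l -> explore v l (upd w x b) = explore v l w.
Proof.
elim: l v => //= y l IHl v; rewrite inE negb_or => /andP[xy xl].
have yE : upd w x b y = w y by rewrite /upd eq_sym (negbTE xy).
by rewrite /explore /= yE; exact: IHl.
Qed.

(** The decision to reveal [x] is taken before its state is read. *)
Lemma reveals_upd v l x w b : reveals v l x (upd w x b) = reveals v l x w.
Proof.
rewrite /reveals explore_upd//; have [xl|/(contra _) ->//] := boolP (x \in l).
  by rewrite in_take// ltnn.
by move=> /mem_take.
Qed.

(* Induction on l, after Homin Lee's proof of the OSSS inequality: conditioning
   on the first revealed site x splits the covariance into covariances with the
   explorations of the tail, which do not depend on x, plus a term bounded by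
   the influence of x. *)
Lemma osss (p : R) s l (g : (I -> bool) -> R) v w :
  0 <= p <= 1 -> (forall v, 0 <= res v <= 1) -> uniq l -> {subset l <= s} ->
  mean p s (fun w => res (explore v l w) * g w) w -
    mean p s (fun w => res (explore v l w)) w * mean p s g w <=
  \sum_(x <- l) p * (1 - p) * mean p s (fun w => (reveals v l x w)%:R) w *
    mean p s (fun w => `|gap x g w|) w.
Proof.
move=> p01 res01; have /andP[p0 p1] := p01.
have pp0 : 0 <= p * (1 - p) by rewrite mulr_ge0// subr_ge0.
elim: l v => [|x l IHl] v.
  move=> _ _; rewrite big_nil /= meanZ mean_cst subrr//.
move=> /= /andP[xl ul] xls.
have xs : x \in s by apply: xls; rewrite inE eqxx.
have ls : {subset l <= s} by move=> y yl; apply: xls; rewrite inE yl orbT.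
have gap0 y : 0 <= mean p s (fun w => `|gap y g w|) w by apply: mean_ge0.
have step y : y \in l -> reveals v (x :: l) y =
    fun w => reveals (if skip v x then v else reveal v x (w x)) l y w.
  move=> yl; apply/funext => w'; rewrite /reveals /=.
  by case: eqP => // xy; rewrite xy yl in xl.
have rx : reveals v (x :: l) x = fun=> ~~ skip v x.
  by apply/funext => w'; rewrite /reveals /= eqxx.
rewrite big_cons rx.
rewrite mean_cst.
have [vx|vx] := boolP (skip v x).
  rewrite mulr0 mul0r add0r; apply: le_trans (IHl v ul ls) _.
  by rewrite !big_seq; apply: ler_sum => y yl; rewrite step// vx.
pose F b w := res (explore (reveal v x b) l w).
have Fx b : ignores x (F b) by move=> ? ?; rewrite /F explore_upd.
have F01 b w' : 0 <= F b w' <= 1 by exact: res01.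
have avgF b : mean p s (fun w => F b w * avg p x g w) w = mean p s (fun w => F b w * g w) w.
  rewrite -(mean_avg p (fun w => F b w * g w) xs); congr (mean p s _ w).
  by apply/funext => w'; rewrite /avg !Fx; ring.
(* With [m = avg p x g], the value of [g] is [m + (1 - p) * gap x g] when [x] is [false] and
   [m - p * gap x g] when it is [true]. *)
have -> : mean p s (fun w => F (w x) w * g w) w =
    p * mean p s (fun w => F false w * g w) w +
    (1 - p) * mean p s (fun w => F true w * g w) w +
    p * (1 - p) * mean p s (fun w => (F false w - F true w) * gap x g w) w.
  rewrite -!avgF -mean_lin -meanZ -meanD -(mean_avg p _ xs); congr (mean p s _ w).
  by apply/funext => w'; rewrite /avg /gap /upd eqxx -!/(upd _ _ _) !Fx; ring.
have -> : mean p s (fun w => F (w x) w) w =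
    p * mean p s (F false) w + (1 - p) * mean p s (F true) w by exact: mean_cond.
have Fgap : mean p s (fun w => (F false w - F true w) * gap x g w) w <=
    mean p s (fun w => `|gap x g w|) w.
  apply: le_mean => // w'; apply: le_trans (ler_norm _) _.
  rewrite normrM ler_piMl// ler_norml.
  have /andP[? ?] := F01 false w'; have /andP[? ?] := F01 true w'.
  by apply/andP; split; lra.
have IH b := IHl (reveal v x b) ul ls.
rewrite mulr1.
have -> : \sum_(y <- l) p * (1 - p) * mean p s (fun w => (reveals v (x :: l) y w)%:R) w *
      mean p s (fun w => `|gap y g w|) w =
    p * \sum_(y <- l) p * (1 - p) * mean p s (fun w => (reveals (reveal v x false) l y w)%:R) w *
      mean p s (fun w => `|gap y g w|) w +
    (1 - p) * \sum_(y <- l) p * (1 - p) * mean p s (fun w => (reveals (reveal v x true) l y w)%:R) w *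
      mean p s (fun w => `|gap y g w|) w.
  rewrite !mulr_sumr -big_split !big_seq/=; apply: eq_bigr => y yl.
  rewrite step// (negbTE vx).
  rewrite (@mean_cond _ _ p s x (fun b w => (reveals (reveal v x b) l y w)%:R))//.
    by ring.
  move=> b w' c; rewrite /reveals explore_upd//.
  by apply: contra xl => /mem_take.
have := ler_wpM2l pp0 Fgap; have := ler_wpM2l p0 (IH false).
have q0 : 0 <= 1 - p by rewrite subr_ge0.
have := ler_wpM2l q0 (IH true).
rewrite -/(F false) -/(F true).
lra.
Qed.

End osss.

(** * Finite events under the Bernoulli measure *)

Section finite_events.
Context (R : realType) (I : countType) (q : R).
Hypothesis q01 : 0 <= q <= 1.
Local Notation mu := (bernoulli_measure I q).

Lemma measurable_coordinate (i : I) (B : set bool) :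
  measurable [set w : configuration I | B (w i)].
Proof. by apply: sub_sigma_algebra; exists i, B. Qed.

Let weight (b : bool) : R := if b then q else 1 - q.

Lemma bernoulli_measure_cylinder (l : seq I) (w0 : I -> bool) : uniq l ->
  mu [set w | forall i, i \in l -> w i = w0 i] = (\prod_(i <- l) weight (w0 i))%:E.
Proof.
move=> ul; have bE (b c : bool) : (b \in [set c]) = (b == c).
  by apply/idP/eqP => [/set_mem//|->]; exact: mem_set.
have := @bernoulli_measureP R I q [fset i in l]%fset (fun i => [set w0 i]).
rewrite (_ : [set w | _] = [set w | forall i, i \in l -> w i = w0 i]); last first.
  by apply/seteqP; split => w /= wl i il; apply: wl; rewrite ?inE// in il *.
move=> ->; rewrite -prodEFin (perm_big l).
  apply: eq_bigr => i _; rewrite bernoulli_probE// !diracE /weight.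
  by case: (w0 i); rewrite !bE /= /unstable.onem; congr EFin; ring.
by apply: uniq_perm => [|//|i]; [exact: fset_uniq|rewrite inE].
Qed.

(** The induction moves the sites of [s] one by one into the pinned list [l]; when none is left, the
    event is a cylinder or empty. The parameter is [1 - q] because [mean] takes the probability of
    [false]. *)
Lemma bernoulli_measure_pinned (s l : seq I) (w0 : I -> bool)
    (P : (I -> bool) -> bool) : uniq (l ++ s) ->
  (forall v v', {in l ++ s, v =1 v'} -> P v = P v') ->
  measurable [set w : configuration I | (forall i, i \in l -> w i = w0 i) /\ P w] /\
  mu [set w : configuration I | (forall i, i \in l -> w i = w0 i) /\ P w] =
  ((\prod_(i <- l) weight (w0 i)) * mean (1 - q) s (fun w => (P w)%:R) w0)%:E.
Proof.
elim: s l w0 => [|x s IHs] l w0.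
  rewrite cats0 => ul Pl /=.
  have mcyl : measurable [set w : configuration I | forall i, i \in l -> w i = w0 i].
    rewrite (_ : mkset _ = \bigcap_(i in [set` l]) [set w : configuration I | [set w0 i] (w i)]) //.
    by apply: fin_bigcap_measurable => // i _; exact: measurable_coordinate.
  have [Pw0|Pw0] := boolP (P w0).
    rewrite mulr1 -bernoulli_measure_cylinder//.
    rewrite (_ : [set w | _] = [set w : configuration I | forall i, i \in l -> w i = w0 i])//.
    by apply/seteqP; split => w /= => [[]//|wl]; split=> //; rewrite (Pl w w0).
  rewrite mulr0 (_ : [set w | _] = set0) ?measure0//.
  by apply/seteqP; split => w //= [wl]; rewrite (Pl w w0)// (negbTE Pw0).
rewrite cat_uniq /= negb_or => /and3P[ul /andP[xl ls] /andP[xs us]] Pls.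
pose E b := [set w : configuration I |
  (forall i, i \in x :: l -> w i = upd w0 x b i) /\ P w].
have updE b i : i \in l -> upd w0 x b i = w0 i.
  by move=> il; rewrite /upd; case: eqP => // ix; rewrite -ix il in xl.
have uls : uniq ((x :: l) ++ s).
  by rewrite /= mem_cat negb_or xl xs cat_uniq ul us ls.
have Pxls v v' : {in (x :: l) ++ s, v =1 v'} -> P v = P v'.
  move=> vv'; apply: Pls => i; rewrite mem_cat inE => ils; apply: vv'.
  by rewrite inE mem_cat orbCA.
have mE b := (IHs (x :: l) (upd w0 x b) uls Pxls).1.
have muE b := (IHs (x :: l) (upd w0 x b) uls Pxls).2.
have EU : [set w : configuration I | (forall i, i \in l -> w i = w0 i) /\ P w] =
    E false `|` E true.
  apply/seteqP; split => w /=.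
    move=> [wl Pw]; case wx : (w x); [right|left]; split=> // i;
      rewrite inE => /predU1P[->|il];
      by [rewrite wx /upd eqxx|rewrite updE ?wl].
  by case=> -[wl Pw]; split=> // i il; rewrite wl ?inE ?il ?orbT//; exact: updE.
rewrite EU; split; first by apply: measurableU; exact: mE.
have E0 : E false `&` E true = set0.
  apply/seteqP; split => w //= [[w1 _] [w2 _]].
  by have := w1 x; have := w2 x; rewrite !inE eqxx /upd eqxx => /(_ isT) -> /(_ isT).
rewrite (measureU _ (mE false) (mE true) E0).
rewrite [X in (X + _)%E]muE [X in (_ + X)%E]muE -EFinD; congr EFin.
rewrite !big_cons /avg.
have bigE b : \prod_(i <- l) weight (upd w0 x b i) = \prod_(i <- l) weight (w0 i).
  by rewrite !big_seq; apply: eq_bigr => i il; rewrite updE.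
by rewrite !bigE /weight /upd eqxx; ring.
Qed.

Lemma finite_event (s : seq I) (w0 : I -> bool) (P : (I -> bool) -> bool) :
  uniq s -> (forall v v', {in s, v =1 v'} -> P v = P v') ->
  measurable [set w : configuration I | P w] /\
  mu [set w : configuration I | P w] = (mean (1 - q) s (fun w => (P w)%:R) w0)%:E.
Proof.
move=> us Ps; have [mP PE] := @bernoulli_measure_pinned s [::] w0 P us Ps.
have E : [set w : configuration I | (forall i, i \in [::] -> w i = w0 i) /\ P w] =
    [set w : configuration I | P w].
  by apply/seteqP; split => w //= -[].
by move: mP PE; rewrite E big_nil mul1r.
Qed.

End finite_events.

(** By [finite_event], both sides are the measure of the same event. *)
Lemma eq_mean_superset (R : realType) (I : countType) (p : R) (s s' : seq I)
    (w : I -> bool) (P : (I -> bool) -> bool) : 0 <= p <= 1 ->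
  uniq s -> uniq s' -> {subset s <= s'} ->
  (forall v v', {in s, v =1 v'} -> P v = P v') ->
  mean p s' (fun w => (P w)%:R) w = mean p s (fun w => (P w)%:R) w.
Proof.
move=> /andP[p0 p1] us us' ss' Ps.
have q01 : 0 <= 1 - p <= 1 by apply/andP; split; lra.
have Ps' v v' : {in s', v =1 v'} -> P v = P v'.
  by move=> vv'; apply: Ps => i /ss'; exact: vv'.
have [_ E] := finite_event q01 w us Ps; have [_ E'] := finite_event q01 w us' Ps'.
have pE : 1 - (1 - p) = p by ring.
by move: E' E; rewrite pE => -> [].
Qed.

(** For [tau] a translation, this is the translation invariance of the product law. *)
Lemma mean_map (R : realType) (I : eqType) (p : R) (tau : I -> I) (s : seq I)
    (f : (I -> bool) -> R) (w : I -> bool) : injective tau ->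
  mean p (map tau s) (fun w => f (w \o tau)) w = mean p s f (w \o tau).
Proof.
move=> tau_inj; elim: s w => //= x s IHs w.
have updE b : upd w (tau x) b \o tau = upd (w \o tau) x b.
  by apply/funext => y; rewrite /upd /= (inj_eq tau_inj).
by rewrite /avg !IHs !updE.
Qed.

(** * Infection and its exploration *)

Section infection.
Context (d : nat) (F : {fset {fset 'rV[int]_d}}).
Local Notation site := 'rV[int]_d.
Implicit Types (w v : site -> bool) (x y z : site) (s l : seq site).

Inductive infected w : site -> Prop :=
| infected_initially x : w x -> infected w x
| infected_update x X : X \in F -> (forall y, y \in X -> infected w (x + y)) ->
    infected w x.

Lemma infected_sub w w' x : (forall y, w y -> infected w' y) ->
  infected w x -> infected w' x.
Proof.
move=> ww'; elim=> {x} [x /ww'//|x X XF _ IH]; exact: infected_update XF IH.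
Qed.

Lemma infected_mono w w' x : (forall y, w y -> w' y) ->
  infected w x -> infected w' x.
Proof. by move=> ww'; apply: infected_sub => y /ww'; exact: infected_initially. Qed.

(** Sites outside [s] are only made healthy initially. When [s] is a slab and no update set is
    empty, those above its top remain healthy, since their update sets lie still higher. *)
Definition restr s w : site -> bool := fun z => (z \in s) && w z.

Lemma infected_restr_mono s s' w x : {subset s <= s'} ->
  infected (restr s w) x -> infected (restr s' w) x.
Proof. by move=> ss'; apply: infected_mono => y /andP[/ss' ys' wy]; apply/andP. Qed.

Lemma eq_restr s w w' : {in s, w =1 w'} -> restr s w = restr s w'.
Proof.
move=> ww'; apply/funext => z; rewrite /restr.
by case: (boolP (z \in s)) => //= /ww' ->.
Qed.

Lemma bp_stepP w x :
  bp_step F w x <-> w x \/ exists2 X, X \in F & forall y, y \in X -> w (x + y).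
Proof.
rewrite /bp_step; split=> [/orP[|/existsP[X /forallP wX]]|[->//|[X XF wX]]].
- by left.
- right; exists (val X); first exact: valP.
  by move=> y yX; exact: (wX [` yX]%fset).
- apply/orP; right; apply/existsP; exists [` XF]%fset; apply/forallP => y.
  by apply: wX; exact: valP.
Qed.

Definition known_infected v x : bool := `[< infected v x \/ infected v 0 >].

(** A healthy state leaves no trace: the exploration consults only the closure of the infected sites
    found. *)
Definition record_state v x (b : bool) : site -> bool :=
  fun z => v z || ((z == x) && b).

Local Notation probe := (explore known_infected record_state).

Lemma explore_ge v l w z : v z -> probe v l w z.
Proof.
elim: l v => //= x l IHl v vz; apply: IHl.
by case: ifP => // _; rewrite /record_state vz.
Qed.

Lemma explore_le v l w z : probe v l w z -> v z || (z \in l) && w z.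
Proof.
elim: l v => [|x l IHl] v /=; first by move=> ->.
move=> /IHl /orP[|/andP[zl ->]]; last by rewrite inE zl orbT orbT.
case: ifP => _; first by move=> ->.
rewrite /record_state => /orP[->//|/andP[/eqP -> ->]].
by rewrite inE eqxx orbT.
Qed.

(* A skipped site is already infected, so its initial state does not matter;
   once the origin is infected everything is skipped. *)
Lemma explore_infected v l w z :
  infected (fun z => v z || (z \in l) && w z) z ->
  infected (probe v l w) z \/ infected (probe v l w) 0.
Proof.
elim: l v => [|x l IHl] v /=.
  by left; apply: infected_mono H => y; rewrite orbF.
move=> H; case: ifP => [/asboolP[vx|v0]|_].
- apply: IHl; apply: infected_sub H => y; rewrite inE.
  have mono_v : forall y, v y -> v y || (y \in l) && w y by move=> ? ->.
  move=> /orP[vy|/andP[/predU1P[->|yl] wy]].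
  + by apply: infected_initially; exact: mono_v.
  + exact: infected_mono vx.
  + by apply: infected_initially; rewrite yl wy orbT.
- by right; apply: infected_mono v0 => y; exact: explore_ge.
- apply: IHl; apply: infected_mono H => y; rewrite inE /record_state.
  by have [->|] := eqVneq y x => /= [|_]; do ?case: (_ y); do ?case: (_ x); rewrite ?orbT.
Qed.

Lemma explore_infected_restr l w z :
  infected (restr l w) z ->
  infected (probe (fun=> false) l w) z \/ infected (probe (fun=> false) l w) 0.
Proof. exact: (@explore_infected (fun=> false) l w z). Qed.

(** At the origin the two alternatives of [explore_infected_restr] coincide, so the exploration
    decides this event in whatever order the sites are scanned. *)
Lemma explore_infected0 l w :
  infected (probe (fun=> false) l w) 0 <-> infected (restr l w) 0.
Proof.
split=> [|/explore_infected_restr[]//].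
by apply: infected_mono => y /explore_le.
Qed.

(** Otherwise the sites scanned before [x] would make [x] or the origin known to be infected, and
    [x] would be skipped. Revealment probabilities are thereby bounded by probabilities of staying
    healthy. *)
Lemma reveals_healthy l w x : reveals known_infected record_state (fun=> false) l x w ->
  ~ infected (restr (take (index x l) l) w) x /\
  ~ infected (restr (take (index x l) l) w) 0.
Proof.
move=> /asboolP H; split=> /explore_infected_restr h; apply: H; tauto.
Qed.

(** * Pieces of bounded height in the cone generated by the update sets *)

Section slab.
Context (h : site -> int).
Hypothesis hD : forall x y, h (x + y) = h x + h y.
Hypothesis h_gt0 : forall X, X \in F -> forall y, y \in X -> 0 < h y.

Let moves : seq site := flatten [seq enum_fset X | X <- enum_fset F].

Let movesP y : reflect (exists2 X, X \in F & y \in X) (y \in moves).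
Proof.
by apply: (iffP (@flatten_mapP _ _ (fun X : {fset site} => enum_fset X)
  (enum_fset F) y)) => -[X XF yX]; exists X.
Qed.

Let h0 : h 0 = 0. Proof. by have := hD 0 0; rewrite addr0; lia. Qed.

Inductive cone : site -> Prop :=
| cone0 : cone 0
| coneD z y : cone z -> y \in moves -> cone (z + y).

Let cone_h z : cone z -> z = 0 \/ 0 < h z.
Proof.
elim=> [|{}z y _ IH /movesP[X XF /(h_gt0 XF) hy]]; first by left.
by right; rewrite hD; case: IH => [->|]; rewrite ?h0; lia.
Qed.

Let cone_add x z : cone x -> cone z -> cone (x + z).
Proof.
move=> cx; elim=> [|{}z y _ cxz ym]; first by rewrite addr0.
by rewrite addrA; exact: coneD.
Qed.

Fixpoint reach n : seq site :=
  if n is m.+1 then reach m ++ [seq z + y | z <- reach m, y <- moves] else [:: 0].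

Definition slab n : seq site := undup [seq z <- reach n | h z <= n%:Z].

(** Each move raises the integral height by at least 1, so [n] moves from the origin reach every
    site of the cone of height at most [n]. *)
Lemma slabP n z : z \in slab n <-> cone z /\ h z <= n%:Z.
Proof.
rewrite mem_undup mem_filter; split=> [/andP[-> zn]|[cz]].
  split=> //; elim: n z zn => [|n IHn] z /=.
    by rewrite inE => /eqP ->; exact: cone0.
  rewrite mem_cat => /orP[/IHn//|/allpairsP[[a b] /= [/IHn ca bm ->]]].
  exact: coneD.
move=> hz; rewrite hz /=; elim: cz n hz => [|{}z y cz IH ym] n.
  by move=> _; elim: n => [|n IHn]; rewrite ?inE//= mem_cat IHn.
have /movesP[X XF /(h_gt0 XF) hy] := ym; rewrite hD => hzy.
have hz0 : 0 <= h z by case: (cone_h cz) => [->|]; rewrite ?h0// => /ltW.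
case: n hzy => [|n] hzy; first by lia.
rewrite /= mem_cat; apply/orP; right; apply/allpairsP; exists (z, y); split=> //=.
by apply: IH; lia.
Qed.

Lemma slab_uniq n : uniq (slab n). Proof. exact: undup_uniq. Qed.

Lemma slab0 n : 0 \in slab n.
Proof. by apply/slabP; split; [exact: cone0|rewrite h0]. Qed.

Lemma slab_move n z X y : z \in slab n -> X \in F -> y \in X ->
  h (z + y) <= n%:Z -> z + y \in slab n.
Proof.
move=> /slabP[cz _] XF yX hzy; apply/slabP; split=> //.
by apply: coneD => //; apply/movesP; exists X.
Qed.

Lemma slab_sub m n : (m <= n)%N -> {subset slab m <= slab n}.
Proof. by move=> mn z /slabP[cz hz]; apply/slabP; split=> //; lia. Qed.

Lemma slab_h n z : z \in slab n -> z = 0 \/ 0 < h z.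
Proof. by move=> /slabP[/cone_h]. Qed.

Lemma slab_h_ge0 n z : z \in slab n -> 0 <= h z.
Proof. by move=> /slab_h[->|/ltW//]; rewrite h0. Qed.

Lemma slab_add m n x z : x \in slab n -> z \in slab m -> h x + m%:Z <= n%:Z ->
  x + z \in slab n.
Proof.
move=> /slabP[cx hx] /slabP[cz hz] hn; apply/slabP; split; first exact: cone_add.
by rewrite hD; lia.
Qed.

(** By induction on the infection, a site [z] is infected after [n - h z] steps, because the sites
    of its update set are at least 1 higher. Nonempty update sets are what keeps infected sites at
    height at most [n]. *)
Lemma infected_slab_bp n w : fset0 \notin F ->
  infected (restr (slab n) w) 0 -> bp F w n 0.
Proof.
move=> F0 I0; suff : forall z, infected (restr (slab n) w) z ->
    h z <= n%:Z /\ forall m, n%:Z - h z <= m%:Z -> iter m (bp_step F) w z.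
  by move=> /(_ 0 I0)[_]; apply; rewrite h0; lia.
move=> z; elim=> {z} [z /andP[/slabP[_ hz] wz]|z X XF _ IH].
  split=> // m _; elim: m => //= m IHm.
  by apply/bp_stepP; left.
have [X0|[y yX]] := fset_0Vmem X; first by rewrite -X0 XF in F0.
have [hzy _] := IH y yX; have hy := h_gt0 XF yX; rewrite hD in hzy.
split=> [|m hm]; first by lia.
case: m hm => [|m] hm; first by lia.
apply/bp_stepP; right; exists X => // y' y'X.
have [hzy' it] := IH y' y'X; apply: it; rewrite hD; have := h_gt0 XF y'X; lia.
Qed.

(** One step looks at most [M] higher, and [bp F w t] makes [t.+1] steps. *)
Lemma bp_infected_slab (M n t : nat) w :
  (forall X, X \in F -> forall y, y \in X -> h y <= M%:Z) ->
  (M * t.+1 <= n)%N -> bp F w t 0 -> infected (restr (slab n) w) 0.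
Proof.
move=> hM Mn; suff : forall m z, z \in slab n -> h z + (M * m)%:Z <= n%:Z ->
    iter m (bp_step F) w z -> infected (restr (slab n) w) z.
  by apply; [exact: slab0|rewrite h0; lia].
elim=> [|m IHm] z zn hz; first by move=> wz; apply: infected_initially; rewrite /restr zn.
move=> /bp_stepP[|[X XF wX]]; first by apply: IHm => //; lia.
apply: (infected_update XF) => y yX; have hy := hM X XF y yX.
rewrite mulnS in hz; apply: IHm; [|by rewrite hD; lia|exact: wX].
by apply: slab_move zn XF yX _; rewrite hD; lia.
Qed.

End slab.
End infection.

(** * The differential inequality *)

Lemma mem_take_sorted (T : eqType) (key : T -> nat) (l : seq T) x z :
  sorted (relpre key leq) l -> x \in l -> z \in l -> (key z < key x)%N ->
  z \in take (index x l) l.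
Proof.
move=> sl xl zl zx; rewrite in_take// ltnNge; apply: contraL zx => xz.
rewrite -leqNgt -{1}(nth_index x xl) -(nth_index x zl).
have tr : transitive (relpre key leq) by move=> a b c; exact: leq_trans.
have rfl : reflexive (relpre key leq) by move=> a /=.
by apply: (sorted_leq_nth tr rfl x sl); rewrite ?inE ?index_mem.
Qed.

(** The indices [k - m] and the indices [k] each meet every value below [n] at most once. *)
Lemma sum_distance_le (R : realDomainType) (a : nat -> R) (m n : nat) :
  (forall j, 0 <= a j) ->
  \sum_(0 <= k < n) (if (m <= k)%N then a (k - m)%N else a k) <=
  2 * \sum_(0 <= j < n) a j.
Proof.
move=> a0; rewrite mulr2n mulrDl mul1r.
apply: (@le_trans _ _ (\sum_(0 <= k < n) ((if (m <= k)%N then a (k - m)%N else 0) + a k))).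
  by apply: ler_sum => k _; case: ifP => _; rewrite ?lerDl ?add0r.
rewrite big_split/= lerD2r.
have [mn|mn] := leqP m n; last first.
  rewrite big_nat big1 ?sumr_ge0// => k /= kn.
  by rewrite leqNgt (leq_ltn_trans _ mn)// ltnW.
rewrite (big_cat_nat (n := m))//= big_nat big1 ?add0r; last first.
  by move=> k /= km; rewrite leqNgt km.
rewrite -{1}[m]add0n big_addn.
rewrite (eq_bigr a) => [|k _]; last by rewrite leq_addl addnK.
by rewrite [leRHS](@big_cat_nat _ _ _ (n - m))//= ?leq_subr// lerDl sumr_ge0.
Qed.

Section differential_inequality.
Context (R : realType) (d : nat) (F : {fset {fset 'rV[int]_d}}).
Local Notation site := 'rV[int]_d.
Context (h : site -> int).
Hypothesis hD : forall x y, h (x + y) = h x + h y.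
Hypothesis h_gt0 : forall X, X \in F -> forall y, y \in X -> 0 < h y.

Local Notation slab := (slab F h).
Local Notation infected := (infected F).

Definition healthy_on (s : seq site) (w : site -> bool) : bool :=
  `[< ~ infected (restr s w) 0 >].

Definition theta (n : nat) (p : R) : R :=
  mean p (slab n) (fun w => (healthy_on (slab n) w)%:R) (fun=> false).

Definition dtheta (n : nat) (p : R) : R :=
  \sum_(x <- slab n)
    mean p (slab n) (gap x (fun w => (healthy_on (slab n) w)%:R)) (fun=> false).

Lemma is_derive_theta n (p : R) : is_derive p 1 (theta n) (dtheta n p).
Proof. exact/is_derive_mean/slab_uniq. Qed.

Lemma theta01 n p : 0 <= p <= 1 -> 0 <= theta n p <= 1.
Proof.
move=> p01; rewrite mean_ge0 ?mean_le1// => w; case: healthy_on => //.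
Qed.

Lemma healthy_on_eq (s s' : seq site) w w' : {subset s <= s'} -> {in s', w =1 w'} ->
  healthy_on s w = healthy_on s w'.
Proof. by move=> ss' ww'; rewrite /healthy_on (@eq_restr _ s w w')// => x /ss' /ww'. Qed.

(** Infecting a site cannot make the origin healthy. Hence the absolute values in [osss] disappear,
    and the influences add up to the derivative in Russo's formula. *)
Lemma gap_healthy_ge0 s x w : 0 <= gap x (fun w => (healthy_on s w)%:R : R) w.
Proof.
rewrite /gap subr_ge0 ler_nat /healthy_on.
case: asboolP => // H1; case: asboolP => // H2; exfalso; apply: H2 => H2; apply: H1.
apply: infected_mono H2 => y; rewrite /restr /upd.
by case: eqP => // _; rewrite andbF.
Qed.

Lemma dtheta_ge0 n p : 0 <= p <= 1 -> 0 <= dtheta n p.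
Proof.
by move=> p01; apply: sumr_ge0 => x _; apply: mean_ge0 => // w; exact: gap_healthy_ge0.
Qed.

Let depth_key (k : nat) (z : site) : nat :=
  if h z <= k%:Z then `|k%:Z - h z|%N else k.+1.

(* The k-th exploration scans the sites of height at most k from height k down
   to 0, which decides whether the origin is healthy when the sites above
   height k are; only if it is are the remaining sites looked at. *)
Let scan (k n : nat) := sort (relpre (depth_key k) leq) (slab n).

Let mem_scan_take k n x z : x \in slab n -> z \in slab n ->
  (depth_key k z < depth_key k x)%N -> z \in take (index x (scan k n)) (scan k n).
Proof.
move=> xn zn; apply: mem_take_sorted; rewrite ?mem_sort//.
by apply: sort_sorted => a b; exact: leq_total.
Qed.

Local Notation revealed k n x :=
  (reveals (known_infected F) (@record_state d) (fun=> false) (scan k n) x).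

(** The factor [p] is the probability that [x] is initially healthy, which is independent of its
    revealment. The sites higher than [x] up to height [k] are scanned before [x], so [x] is then
    healthy in the translate to [x] of the slab of height [k - h x]. *)
Let reveal_low_le (k n : nat) (p : R) x : 0 <= p <= 1 -> (k <= n)%N ->
  x \in slab n -> h x <= k%:Z ->
  p * mean p (slab n) (fun w => (revealed k n x w)%:R) (fun=> false) <=
  theta `|k%:Z - h x|%N p.
Proof.
move=> p01 kn xn xk; set m := `|_|%N.
have hx0 := slab_h_ge0 hD h_gt0 xn.
have xm : h x + m%:Z <= n%:Z by rewrite /m; lia.
have xscan : x \in scan k n by rewrite mem_sort.
pose H b w : R := (~~ b && revealed k n x w)%:R.
have Hx b : ignores x (H b).
  by move=> w c; rewrite /H reveals_upd.
have := @mean_cond R _ p (slab n) x H (fun=> false) xn Hx.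
rewrite {3}/H mean_cst mulr0 addr0 => <-.
pose tau z := x + z.
pose P w := healthy_on (slab m) (w \o tau).
apply: (@le_trans _ _ (mean p (slab n) (fun w => (P w)%:R) (fun=> false))).
  apply: le_mean => // w; rewrite /H ler_nat.
  case wx : (w x) => //=; case rx : (revealed _ _ _ _) => //=.
  rewrite lt0b; apply/asboolP.
  have [nx _] := reveals_healthy rx => I0; apply: nx.
  set pre := take _ _.
  suff : forall z, infected (restr (slab m) (w \o tau)) z -> infected (restr pre w) (x + z).
    by move=> /(_ 0 I0); rewrite addr0.
  move=> z; elim=> {z} [z /andP[zm wz]|z X XF _ IH].
    apply: infected_initially; apply/andP; split; last exact: wz.
    apply: mem_scan_take => //; first exact: slab_add xm.
    (* The site [x] itself is not in the prefix, but it is initially healthy here; the others are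
       strictly higher, hence scanned earlier. *)
    have [z0|hz] := slab_h hD h_gt0 zm; first by move: wz; rewrite /tau /= z0 addr0 wx.
    have [_ hzm] := (slabP hD h_gt0 m z).1 zm.
    rewrite /depth_key xk ifT hD; [rewrite /m in hzm; lia|rewrite /m in hzm; lia].
  by apply: (infected_update XF) => y yX; rewrite -addrA; exact: IH.
have tau_inj : injective tau by exact: addrI.
have -> : mean p (slab n) (fun w => (P w)%:R) (fun=> false) =
    mean p (map tau (slab m)) (fun w => (P w)%:R) (fun=> false).
  apply: eq_mean_superset => //; rewrite ?map_inj_uniq ?slab_uniq//.
    by move=> _ /mapP[z zm ->]; exact: slab_add xm.
  move=> v v' vv'; apply: healthy_on_eq (fun _ => id) _ => z zm /=.
  by apply: vv'; exact: map_f.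
by rewrite (mean_map p _ (fun w => (healthy_on (slab m) w)%:R)).
Qed.

(** When [x] is revealed, all of [slab k] has been scanned without infecting the origin. *)
Let reveal_high_le (k n : nat) (p : R) x : 0 <= p <= 1 -> (k <= n)%N ->
  x \in slab n -> k%:Z < h x ->
  p * mean p (slab n) (fun w => (revealed k n x w)%:R) (fun=> false) <= theta k p.
Proof.
move=> p01 kn xn kx; have /andP[p0 p1] := p01.
apply: (@le_trans _ _ (mean p (slab n) (fun w => (revealed k n x w)%:R) (fun=> false))).
  by rewrite ler_piMl// mean_ge0.
rewrite /theta -(@eq_mean_superset _ _ p (slab k) (slab n)) ?slab_uniq//; last 2 first.
- exact: slab_sub.
- by move=> v v' vv'; exact: healthy_on_eq vv'.
apply: le_mean => // w; rewrite ler_nat; case rx : (revealed _ _ _ _) => //.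
rewrite lt0b; apply/asboolP; have [_ n0] := reveals_healthy rx => I0; apply: n0.
apply: infected_restr_mono I0 => z zk; have [_ hzk] := (slabP hD h_gt0 k z).1 zk.
apply: mem_scan_take => //; first exact: (slab_sub hD h_gt0 kn).
rewrite /depth_key hzk ifN -?ltNge//.
have := slab_h_ge0 hD h_gt0 zk; lia.
Qed.

Lemma theta_diff_ineq n p : 0 <= p <= 1 ->
  n%:R * (theta n p * (1 - theta n p)) <=
  2 * (1 + \sum_(0 <= j < n) theta j p) * dtheta n p.
Proof.
move=> p01; have /andP[p0 p1] := p01.
pose g (w : site -> bool) : R := (healthy_on (slab n) w)%:R.
pose D x := mean p (slab n) (gap x g) (fun=> false).
pose r k x := mean p (slab n) (fun w => (revealed k n x w)%:R : R) (fun=> false).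
have D0 x : 0 <= D x by apply: mean_ge0 => // w; exact: gap_healthy_ge0.
have r0 k x : 0 <= r k x by apply: mean_ge0.
have theta0 j : 0 <= theta j p by have /andP[] := theta01 j p01.
have one k : theta n p * (1 - theta n p) <= \sum_(x <- slab n) p * r k x * D x.
  pose res v : R := (~~ `[< infected v 0 >])%:R.
  have res01 v : 0 <= res v <= 1 by rewrite /res; case: (~~ _); rewrite lexx ler01.
  (* The exploration computes [g], so the covariance in [osss] is the variance of [g]. *)
  have gE w : res (explore (known_infected F) (@record_state d) (fun=> false) (scan k n) w) = g w.
    rewrite /res /g /healthy_on asbool_neg; congr (~~ _)%:R.
    apply: asbool_equiv_eq; rewrite explore_infected0.
    by rewrite (_ : restr _ w = restr (slab n) w)//; apply/funext => z; rewrite /restr mem_sort.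
  have uscan : uniq (scan k n) by rewrite sort_uniq slab_uniq.
  have sscan : {subset scan k n <= slab n} by move=> x; rewrite mem_sort.
  have := @osss R _ _ (known_infected F) (@record_state d) res p (slab n) (scan k n) g
    (fun=> false) (fun=> false) p01 res01 uscan sscan.
  under eq_fun do rewrite gE.
  rewrite (_ : (fun w => g w * g w) = g); last first.
    by apply/funext => w; rewrite /g; case: healthy_on; rewrite ?mulr1 ?mulr0.
  rewrite (_ : (fun w => res _) = g); last by apply/funext => w; rewrite gE.
  move=> H; rewrite mulrBr mulr1; apply: (le_trans H).
  rewrite (perm_big (slab n)) ?perm_sort//=; apply: ler_sum => x _.
  rewrite (_ : (fun w => `|gap x g w|) = gap x g); last first.
    by apply/funext => w; rewrite ger0_norm// gap_healthy_ge0.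
  rewrite -/(D x) -/(r k x) ler_wpM2r// ler_wpM2r// ler_piMr//; lra.
apply: (@le_trans _ _ (\sum_(0 <= k < n) \sum_(x <- slab n) p * r k x * D x)).
  rewrite mulr_natl (_ : _ *+ n = \sum_(0 <= k < n) theta n p * (1 - theta n p)).
    by apply: ler_sum => k _; exact: one.
  by rewrite sumr_const_nat subn0.
rewrite exchange_big/= /dtheta mulr_sumr [leLHS]big_seq [leRHS]big_seq; apply: ler_sum => x xn.
rewrite -mulr_suml -/(D x) ler_wpM2r//.
apply: (@le_trans _ _ (2 * \sum_(0 <= j < n) theta j p)); last by rewrite ler_wpM2l// lerDr.
have hx0 := slab_h_ge0 hD h_gt0 xn.
(* For fixed [x], the bound for the [k]-th exploration is [theta] at [k - h x] if [h x <= k] and at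
   [k] otherwise. *)
apply: le_trans (@sum_distance_le _ (fun j => theta j p) `|h x|%N n theta0).
rewrite !big_nat; apply: ler_sum => k /= kn.
case: ifPn => hxk.
  rewrite (_ : (k - _)%N = `|k%:Z - h x|%N); last by lia.
  by apply: reveal_low_le => //; lia.
by apply: reveal_high_le => //; lia.
Qed.

End differential_inequality.

(** * Comparison with the percolation probabilities *)

(** Multiply [u] by a large [N] and round the coordinates down. This changes the form at [y] by at
    most [norm1 y], which is less than [N * - dot y] on the finitely many moves. The sign is
    reversed to make heights positive. *)
Lemma integer_half_space (R : realType) (d : nat) (F : {fset {fset 'rV[int]_d}}) :
  in_half_space R F ->
  exists h : 'rV[int]_d -> int, [/\ forall x y, h (x + y) = h x + h y,
    forall X, X \in F -> forall y, y \in X -> 0 < h y &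
    exists M : nat, forall X, X \in F -> forall y, y \in X -> h y <= M%:Z].
Proof.
move=> [u hu]; pose moves := flatten [seq enum_fset X | X <- enum_fset F].
have movesP X y : X \in F -> y \in X -> y \in moves.
  move=> XF yX; apply/(@flatten_mapP _ _ (fun X : {fset 'rV[int]_d} => enum_fset X)).
  by exists X.
pose dot (y : 'rV[int]_d) : R := \sum_(i < d) (y 0 i)%:~R * u 0 i.
pose norm1 (y : 'rV[int]_d) : R := \sum_(i < d) `|(y 0 i)%:~R|.
have dot_lt0 y : y \in moves -> dot y < 0.
  move=> /(@flatten_mapP _ _ (fun X : {fset 'rV[int]_d} => enum_fset X))[X XF yX].
  exact: hu XF _ yX.
have [N HN] : exists N : nat, forall y, y \in moves -> norm1 y < N%:R * - dot y.
  elim: (moves) dot_lt0 => [|y s IHs] hs; first by exists 0.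
  have [|N HN] := IHs; first by move=> z zs; apply: hs; rewrite inE zs orbT.
  have y0 : 0 < - dot y by rewrite oppr_gt0 hs// inE eqxx.
  exists (maxn N (Num.bound (norm1 y / - dot y))) => z; rewrite inE => /predU1P[->|zs].
    rewrite -ltr_pdivrMr//; apply: lt_le_trans (archi_boundP _) _.
      by rewrite divr_ge0 ?(ltW y0) ?sumr_ge0.
    by rewrite ler_nat leq_maxr.
  apply: lt_le_trans (HN z zs) _.
  rewrite ler_wpM2r ?ler_nat ?leq_maxl// oppr_ge0 ltW// hs// inE zs orbT//.
pose a i : int := Num.floor (N%:R * u 0 i).
pose h (z : 'rV[int]_d) : int := - \sum_(i < d) z 0 i * a i.
have h_gt0 y : y \in moves -> 0 < h y.
  move=> ym; rewrite -(ltr_int R) /h rmorphN/= oppr_gt0 rmorph_sum/=.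
  have : \sum_(i < d) (y 0 i * a i)%:~R <= N%:R * dot y + norm1 y.
    rewrite /dot /norm1 mulr_sumr -big_split/=; apply: ler_sum => i _.
    rewrite rmorphM/= addrC -lerBlDr mulrCA -mulrBr.
    apply: le_trans (ler_norm _) _; rewrite normrM ler_piMr//.
    rewrite ler_norml; have := floor_itv (N%:R * u 0 i).
    by rewrite -/(a i) intrD => /andP[? ?]; apply/andP; split; lra.
  have := HN y ym; rewrite mulrN; lra.
exists h; split.
- by move=> x y; rewrite /h -opprD -big_split/=; congr (- _);
    apply: eq_bigr => i _; rewrite mxE mulrDl.
- by move=> X XF y yX; apply/h_gt0/(movesP X).
- exists (\max_(y <- moves) `|h y|%N)%N => X XF y yX.
  have /= := @leq_bigmax_seq _ moves predT (fun y => `|h y|%N) y (movesP X y XF yX) isT.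
  by have := h_gt0 y (movesP X y XF yX); lia.
Qed.

Section bp_measure.
Context (d : nat) (F : {fset {fset 'rV[int]_d}}).
Local Notation site := 'rV[int]_d.

Lemma measurable_iter_bp_step t (x : site) :
  measurable [set w : configuration site | iter t (bp_step F) w x].
Proof.
elim: t x => [|t IHt] x; first exact: (measurable_coordinate x (fun b => b)).
rewrite (_ : [set w | _] = [set w : configuration site | iter t (bp_step F) w x] `|`
  \bigcup_(X in [set` F]) \bigcap_(y in [set` X])
    [set w : configuration site | iter t (bp_step F) w (x + y)]).
  apply: measurableU => //; apply: fin_bigcup_measurable => // X _.
  by apply: fin_bigcap_measurable.
apply/seteqP; split=> w /= => [/bp_stepP[wx|[X XF wX]]|wx].
- by left.
- by right; exists X.
- by apply/bp_stepP; case: wx => [|[X XF wX]]; [left|right; exists X].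
Qed.

Lemma measurable_healthy_at_origin t : measurable (healthy_at_origin F t).
Proof.
rewrite (_ : healthy_at_origin F t = ~` [set w | bp F w t 0])//.
by apply: measurableC; exact: measurable_iter_bp_step.
Qed.

End bp_measure.

Section comparison.
Context (R : realType) (d : nat) (F : {fset {fset 'rV[int]_d}}).
Local Notation site := 'rV[int]_d.
Context (h : site -> int) (M : nat) (q : R).
Hypothesis hD : forall x y, h (x + y) = h x + h y.
Hypothesis h_gt0 : forall X, X \in F -> forall y, y \in X -> 0 < h y.
Hypothesis h_le : forall X, X \in F -> forall y, y \in X -> h y <= M%:Z.
Hypothesis F0 : fset0 \notin F.
Hypothesis q01 : 0 <= q <= 1.
Local Notation mu := (bernoulli_measure site q).

Let healthy_on_slab n :
  measurable [set w : configuration site | healthy_on F (slab F h n) w] /\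
  mu [set w : configuration site | healthy_on F (slab F h n) w] =
  (theta F h n (1 - q))%:E.
Proof.
apply: finite_event => //; first exact: slab_uniq.
by move=> v v' vv'; exact: (@healthy_on_eq _ _ _ _ _ _ (fun _ => id) vv').
Qed.

Lemma healthy_le_theta t : (mu (healthy_at_origin F t) <= (theta F h t (1 - q))%:E)%E.
Proof.
have [mE <-] := healthy_on_slab t.
apply: le_measure; rewrite ?inE//; first exact: measurable_healthy_at_origin.
move=> w wt /=; apply/asboolP => I0; apply: wt.
exact: (infected_slab_bp hD h_gt0 F0 I0).
Qed.

Lemma theta_le_healthy n t : (M * t.+1 <= n)%N ->
  ((theta F h n (1 - q))%:E <= mu (healthy_at_origin F t))%E.
Proof.
move=> Mn; have [mE <-] := healthy_on_slab n.
apply: le_measure; rewrite ?inE//; first exact: measurable_healthy_at_origin.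
move=> w /asboolP nI wt; apply: nI; exact: (bp_infected_slab hD h_gt0 h_le Mn wt).
Qed.

(** One [t] with a small probability controls [theta n] for all [n >= M * t.+1]. *)
Lemma theta_cvg0 : mu (healthy_at_origin F t) @[t --> \oo] --> 0%E ->
  theta F h n (1 - q) @[n --> \oo] --> 0.
Proof.
move=> /fine_cvgP[_ /cvgrPdist_lt hcvg]; apply/cvgrPdist_le => e e0.
have [t _ Ht] := hcvg e e0.
have p01 : 0 <= 1 - q <= 1 by move: q01 => /andP[? ?]; apply/andP; split; lra.
near=> n; rewrite sub0r normrN ger0_norm; last first.
  by have /andP[] := theta01 F h n p01.
have := Ht t (leqnn t); rewrite /= sub0r normrN => /ltW/(le_trans (ler_norm _)).
apply: le_trans; rewrite -lee_fin fineK ?fin_num_measure//.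
  by apply: theta_le_healthy; near: n; exact: nbhs_infty_ge.
exact: measurable_healthy_at_origin.
Unshelve. all: by end_near. Qed.

End comparison.

Lemma healthy_at_origin_fset0 d (F : {fset {fset 'rV[int]_d}}) t :
  fset0 \in F -> healthy_at_origin F t = set0.
Proof.
move=> F0; apply/seteqP; split=> // w; apply.
by apply/bp_stepP; right; exists fset0.
Qed.

(** At [q = 1] the origin is almost surely infected initially. Nonemptiness is what [inf_lt] needs
    to extract an element of the set below a given [q > qc]. *)
Lemma qc_set_nonempty (R : realType) d (F : {fset {fset 'rV[int]_d}}) :
  [set q : R | 0 <= q <= 1 /\
    bernoulli_measure 'rV[int]_d q (healthy_at_origin F t) @[t --> \oo] --> 0%E] !=set0.
Proof.
exists 1; have h01 : 0 <= (1 : R) <= 1 by rewrite ler01 lexx.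
split=> //; rewrite (_ : (fun t => _) = cst 0%E); first exact: cvg_cst.
apply/funext => t /=; apply/eqP; rewrite eq_le measure_ge0 andbT.
have H := bernoulli_measure_cylinder h01 (fun=> false) (isT : uniq [:: 0 : 'rV[int]_d]).
rewrite big_seq1 subrr in H; rewrite -[leRHS]H.
have E : [set w : configuration 'rV[int]_d | forall i, i \in [:: 0] -> w i = false] =
   [set w | [set false] (w 0)].
  apply/seteqP; split=> w /=; first by apply; rewrite inE.
  by move=> w0 i; rewrite inE => /eqP ->.
rewrite E; apply: le_measure; rewrite ?inE.
- exact: measurable_healthy_at_origin.
- exact: (measurable_coordinate 0 [set false]).
- move=> w /= wt; apply/negbTE/negP => w0; apply: wt; rewrite /bp.
  by elim: t.+1 => //= n IHn; apply/bp_stepP; left.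
Qed.

Theorem theorem1p6 (R : realType) (d : nat) (hd : (1 <= d)%N)
    (F : {fset {fset 'rV[int]_d}}) (hF : update_family F)
    (hhalf : in_half_space R F) (q : R) (hq01 : 0 <= q <= 1)
    (hq : qc R F < q) :
  exists c C : R, 0 < c /\ 0 < C /\
    forall t : nat, (0 < t)%N ->
      (bernoulli_measure 'rV[int]_d q (healthy_at_origin F t)
        <= (C * expR (- (c * t%:R)))%:E)%E.
Proof.
(* An empty update set infects every site in the first step. *)
have [F0|F0] := boolP (fset0 \in F).
  exists 1, 1; split=> //; split=> // t _.
  by rewrite healthy_at_origin_fset0// measure0 lee_fin mul1r expR_ge0.
have [h [hD h_gt0 [M h_le]]] := integer_half_space hhalf.
have [q' [q'01 healthy0] q'q] := inf_lt (@qc_set_nonempty R d F) hq.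
have theta0 := theta_cvg0 hD h_gt0 h_le q'01 healthy0.
have /andP[q0 q1] := hq01; have /andP[q'0 q'1] := q'01.
(* Passing to [p = 1 - q] reverses the order: [1 - q] lies strictly below [1 - q'], where [theta]
   tends to 0. *)
have [] := @exponential_decay R (theta F h) (dtheta F h) _ _ _ _ (1 - q) (1 - q').
- exact: is_derive_theta.
- exact: theta01.
- exact: dtheta_ge0.
- exact: theta_diff_ineq.
- lra.
- lra.
- lra.
- exact: theta0.
move=> c [C [c0 C0 thetaC]]; exists c, C; split=> //; split=> // t _.
apply: le_trans (healthy_le_theta hD h_gt0 F0 hq01 t) _.
by rewrite lee_fin; exact: thetaC.
Qed.
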